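(* Let $X$ be an irreducible shift of finite type, let $Y$ be a sofic shift, and let $\pi\colon X \to Y$ be an almost invertible factor code. Let $\nu$ be a measure on $Y$ which is fully supported, $\sigma$-invariant, ergodic, and $\mathfrak{T}_Y$-nonsingular. If $\nu$ is Gibbs for an additive cocycle $\phi\colon\mathfrak{T}_Y\to\mathbb{R}$, then every $\sigma$-invariant measure $\mu$ on $X$ with $\pi_* \mu = \nu$ is $\mathfrak{T}_X$-nonsingular and, in particular, is a $\sigma$-invariant Gibbs measure for $\phi \circ (\pi \times \pi)$.
   Context: A shift space is a closed subset $X\subseteq \mathcal{A}^{\mathbb{Z}}$ ($\mathcal{A}$ a finite discrete alphabet, product topology) that is invariant under the shift $\sigma$, $(\sigma^n x)_0=x_n$. $\mathcal{B}(X)$ is the set of finite words appearing in points of $X$. A shift of finite type is a shift space consisting of all points of $\mathcal{A}^{\mathbb{Z}}$ in which no word from some finite set of forbidden words appears. A factor code $\pi\colon X\to Y$ is a surjective continuous shift-equivariant map between shift spaces; a sofic shift is a shift space that is the image of a shift of finite type under a factor code. $X$ is irreducible if for all $u,v\in\mathcal{B}(X)$ there is $w\in\mathcal{B}(X)$ with $uwv\in\mathcal{B}(X)$. A point $x\in X$ is doubly transitive if every word of $\mathcal{B}(X)$ appears in $x$ infinitely often to the left and infinitely often to the right. A factor code $\pi\colon X\to Y$ from an irreducible shift of finite type onto an (automatically irreducible) sofic shift is almost invertible if every doubly transitive point of $Y$ has a unique $\pi$-preimage. All measures are Borel probability measures; ergodic means ergodic with respect to $\sigma$; fully supported means every nonempty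 open set has positive measure. Gibbs relation: $\mathfrak{T}_X=\{(x,y)\in X\times X : x_n=y_n \text{ for all } n \text{ with } |n|>N, \text{ for some } N\ge 1\}$. A holonomy of $\mathfrak{T}_X$ is a Borel isomorphism $\psi\colon A\to B$ between Borel sets $A,B\subseteq X$ with $(x,\psi(x))\in\mathfrak{T}_X$ for all $x\in A$. A measure $\mu$ is $\mathfrak{T}_X$-nonsingular if for every Borel $A$ with $\mu(A)=0$, the saturation $\mathfrak{T}_X(A)=\{x' : \exists x\in A,\ (x,x')\in\mathfrak{T}_X\}$ has $\mu(\mathfrak{T}_X(A))=0$. An (additive) cocycle is a Borel function $\phi\colon\mathfrak{T}_X\to\mathbb{R}$ with $\phi(x,y)+\phi(y,z)=\phi(x,z)$ whenever $(x,y),(y,z)\in\mathfrak{T}_X$. A measure $\mu$ on $X$ is a Gibbs measure for $\phi$ if it is $\mathfrak{T}_X$-nonsingular and for every holonomy $\psi\colon A\to B$ of $\mathfrak{T}_X$, $\frac{d(\mu\circ\psi)}{d\mu}(x)=\exp(\phi(x,\psi(x)))$ for $\mu$-a.e. $x\in A$, where $(\mu\circ\psi)(E)=\mu(\psi(E))$ for Borel $E\subseteq A$. The cocycle $\phi\circ(\pi\times\pi)$ on $\mathfrak{T}_X$ is $(x,x')\mapsto\phi(\pi(x),\pi(x'))$. *)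

(* Defs.v *)
From HB Require Import structures.
From mathcomp Require Import all_boot all_order all_algebra.
From mathcomp Require Import all_classical all_reals all_analysis.

Set Implicit Arguments.
Unset Strict Implicit.
Unset Printing Implicit Defensive.

Import Order.TTheory GRing.Theory Num.Theory.
Import numFieldNormedType.Exports.

Local Open Scope classical_set_scope.
Local Open Scope ring_scope.

(* Measurable types are pointed in the library, so alphabets are nonempty;
   over the empty alphabet there is no probability measure anyway. *)
#[short(type="alphabetType")]
HB.structure Definition Alphabet := {A of Finite A & Pointed A}.

Definition full_shift (A : alphabetType) : Type :=
  {ptws int -> discrete_topology A}.

HB.instance Definition _ (A : alphabetType) :=
  Pointed.copy (full_shift A) {ptws int -> discrete_topology A}.
HB.instance Definition _ (A : alphabetType) :=
  Topological.copy (full_shift A) {ptws int -> discrete_topology A}.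
HB.instance Definition _ (A : alphabetType) :=
  Measurable.copy (full_shift A) (g_sigma_algebraType (@open (full_shift A))).

Section shift_spaces.
Variable A : alphabetType.
Implicit Types (X : set (full_shift A)) (x y : full_shift A) (u v w : seq A).

Definition left_shift x : full_shift A := fun n => x (n + 1).

Definition shift_space X := closed X /\ left_shift @` X = X.

Definition occurs_at u x (i : int) :=
  u = mkseq (fun k => x (i + k%:Z)) (size u).

Definition language X : set (seq A) :=
  [set u | exists2 x, X x & exists i, occurs_at u x i].

Definition SFT X := shift_space X /\
  exists F : seq (seq A),
    X = [set x | forall u, u \in F -> forall i, ~ occurs_at u x i].

Definition irreducible_shift X := forall u v, language X u -> language X v ->
  exists2 w, language X w & language X (u ++ w ++ v).

Definition doubly_transitive X x := X x /\
  forall u, language X u ->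
    infinite_set [set i : int | i <= 0 /\ occurs_at u x i] /\
    infinite_set [set i : int | 0 <= i /\ occurs_at u x i].

Definition gibbs_rel X : set (full_shift A * full_shift A) :=
  [set p | [/\ X p.1, X p.2 &
    exists2 N : nat, (1 <= N)%N &
      forall n : int, N%:Z < `|n| -> p.1 n = p.2 n]].

Definition saturation X (E : set (full_shift A)) : set (full_shift A) :=
  [set x' | exists2 x, E x & gibbs_rel X (x, x')].

(* Only the restriction of [hol_fun] to [hol_dom] is relevant; the inverse
   Borel map is [hol_inv] restricted to [hol_cod]. *)
Record holonomy X := Holonomy {
  hol_dom : set (full_shift A) ;
  hol_cod : set (full_shift A) ;
  hol_fun : full_shift A -> full_shift A ;
  hol_inv : full_shift A -> full_shift A ;
  measurable_hol_dom : measurable hol_dom ;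
  measurable_hol_cod : measurable hol_cod ;
  hol_dom_sub : hol_dom `<=` X ;
  hol_cod_sub : hol_cod `<=` X ;
  hol_funP : forall x, hol_dom x -> hol_cod (hol_fun x) ;
  hol_invP : forall y, hol_cod y -> hol_dom (hol_inv y) ;
  hol_funK : forall x, hol_dom x -> hol_inv (hol_fun x) = x ;
  hol_invK : forall y, hol_cod y -> hol_fun (hol_inv y) = y ;
  measurable_hol_fun : measurable_fun hol_dom hol_fun ;
  measurable_hol_inv : measurable_fun hol_cod hol_inv ;
  hol_gibbs_rel : forall x, hol_dom x -> gibbs_rel X (x, hol_fun x) }.

End shift_spaces.

Section factor_codes.
Variables A B : alphabetType.
Implicit Types (X : set (full_shift A)) (Y : set (full_shift B)).

(* A code X -> Y is the restriction to X of a map between full shifts, whose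
   values outside X are irrelevant. *)
Definition factor_code X Y (pi : full_shift A -> full_shift B) :=
  [/\ shift_space X, shift_space Y, {within X, continuous pi},
      (forall x, X x -> pi (left_shift x) = left_shift (pi x)) & pi @` X = Y].

Definition almost_invertible X Y (pi : full_shift A -> full_shift B) :=
  forall y, doubly_transitive Y y -> exists! x, X x /\ pi x = y.

End factor_codes.

Definition sofic (B : alphabetType) (Y : set (full_shift B)) :=
  exists (A : alphabetType) (X : set (full_shift A))
         (pi : full_shift A -> full_shift B), SFT X /\ factor_code X Y pi.

Section holonomy_measure.
Local Open Scope ereal_scope.
Variables (R : realType) (A : alphabetType) (X : set (full_shift A)).
Variables (mu : probability (full_shift A) R) (psi : holonomy X).

(* mu o psi, extended by 0 outside the domain of psi. *)
Definition holonomy_measure : set (full_shift A) -> \bar R :=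
  fun E => mu (hol_fun psi @` (E `&` hol_dom psi)).

Local Lemma holonomy_imageE E : hol_fun psi @` (E `&` hol_dom psi) =
  hol_cod psi `&` hol_inv psi @^-1` E.
Proof.
apply/seteqP; split=> [_ [x [Ex Dx] <-]|y [Cy Ey]] /=.
  by split; [exact: hol_funP|rewrite hol_funK].
by exists (hol_inv psi y); [split=> //; exact: hol_invP|exact: hol_invK].
Qed.

Let measurable_holonomy_image E : measurable E ->
  measurable (hol_fun psi @` (E `&` hol_dom psi)).
Proof.
move=> mE; rewrite holonomy_imageE.
by apply: measurable_hol_inv => //; exact: measurable_hol_cod.
Qed.

Let holonomy_measure0 : holonomy_measure set0 = 0.
Proof. by rewrite /holonomy_measure set0I image_set0 measure0. Qed.

Let holonomy_measure_ge0 E : 0 <= holonomy_measure E.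
Proof. exact: measure_ge0. Qed.

Let holonomy_measure_sigma_additive : semi_sigma_additive holonomy_measure.
Proof.
move=> F mF tF mUF; rewrite /holonomy_measure.
have -> : hol_fun psi @` (\bigcup_n F n `&` hol_dom psi) =
    \bigcup_n (hol_fun psi @` (F n `&` hol_dom psi)).
  by rewrite setI_bigcupl image_bigcup.
apply: measure_semi_sigma_additive.
- by move=> n; exact: measurable_holonomy_image.
- apply/trivIsetP => i j _ _ ij; rewrite !holonomy_imageE setIACA setIid.
  rewrite -preimage_setI.
  by move/trivIsetP : tF => /(_ _ _ _ _ ij) ->//; rewrite preimage_set0 setI0.
- by apply: bigcup_measurable => n _; exact: measurable_holonomy_image.
Qed.

HB.instance Definition _ := isMeasure.Build _ _ _ holonomy_measure
  holonomy_measure0 holonomy_measure_ge0 holonomy_measure_sigma_additive.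

Let holonomy_measure_fin : fin_num_fun holonomy_measure.
Proof.
by move=> E mE; apply: fin_num_measure; exact: measurable_holonomy_image.
Qed.

HB.instance Definition _ := Measure_isFinite.Build _ _ _ holonomy_measure
  holonomy_measure_fin.

End holonomy_measure.

(* A measure on a shift space X is represented by a probability measure mu on
   the full shift with mu X = 1 (X is closed, hence Borel). *)
Section measures.
Local Open Scope ereal_scope.
Local Open Scope charge_scope.
Variables (R : realType) (A : alphabetType) (X : set (full_shift A)).
Implicit Types (mu : probability (full_shift A) R).
Implicit Types (phi : full_shift A * full_shift A -> R).

Definition measure_on mu := mu X = 1.

Definition fully_supported mu :=
  forall U : set (full_shift A), open U -> U `&` X !=set0 -> 0 < mu (U `&` X).

Definition shift_invariant mu :=
  forall E, measurable E -> mu (@left_shift A @^-1` E) = mu E.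

Definition ergodic mu :=
  forall E, measurable E -> E `<=` X -> @left_shift A @^-1` E = E ->
    mu E = 0 \/ mu E = 1.

Definition nonsingular mu :=
  forall E, measurable E -> E `<=` X -> mu E = 0 -> mu (saturation X E) = 0.

(* The values of phi outside gibbs_rel X are irrelevant. *)
Definition cocycle phi := measurable_fun (gibbs_rel X) phi /\
  forall x y z, gibbs_rel X (x, y) -> gibbs_rel X (y, z) ->
    (phi (x, y) + phi (y, z) = phi (x, z))%R.

(* Nonsingularity makes mu o psi absolutely continuous with respect to mu, so
   the library's Radon-Nikodym derivative takes no default value here. *)
Definition gibbs_measure phi mu := [/\ cocycle phi, nonsingular mu &
  forall psi : holonomy X,
    {ae mu, forall x, hol_dom psi x ->
      ('d (charge_of_finite_measure (holonomy_measure mu psi)) '/d mu) x =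
        (expR (phi (x, hol_fun psi x)))%:E}].

End measures.

Arguments measure_on {R A} X mu.
Arguments fully_supported {R A} X mu.
Arguments ergodic {R A} X mu.
Arguments nonsingular {R A} X mu.
Arguments cocycle {R A} X phi.
Arguments gibbs_measure {R A} X phi mu.

(* Main.v *)
(* By ergodicity and full support, nu-almost every point of Y is doubly
   transitive. Above the doubly transitive points pi is injective, and its
   inverse is Borel because images of closed sets are compact. Double
   transitivity depends only on the tails of a point and pi, being a sliding
   block code, maps Gibbs-related points to Gibbs-related points; so on a set
   of full measure pi intertwines the two Gibbs relations, null sets and
   holonomies of X are carried to those of Y, and the Radon-Nikodym derivative
   of mu o psi is the one of the transported holonomy composed with pi. *)

Require Import Defs.
From mathcomp Require Import all_boot all_order all_algebra.
From mathcomp Require Import all_classical all_reals all_analysis.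
From mathcomp Require Import measurable_realfun zify.

Set Implicit Arguments.
Unset Strict Implicit.
Unset Printing Implicit Defensive.

Import Order.TTheory GRing.Theory Num.Theory.

Local Open Scope classical_set_scope.

(** * Topology and Borel structure of the full shift *)

Section full_shift_topology.
Local Open Scope ring_scope.
Variable A : alphabetType.
Implicit Types (x y z : full_shift A) (E U : set (full_shift A)).

Definition cylinder x (N : nat) : set (full_shift A) :=
  [set z | forall n : int, `|n| <= N%:Z -> z n = x n].

(** The product topology is the supremum of the topologies pulled back along the coordinates, and
    convergence of a coordinate in a discrete alphabet is eventual equality. *)
Lemma full_shift_cvg (F : set_system (full_shift A)) x : Filter F ->
  F --> x <-> forall n, F [set z | z n = x n].
Proof.
move=> FF; split=> [Fx n|Fx].
  have /cvg_sup /(_ n) : F --> (x : {ptws int -> discrete_topology A}) := Fx.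
  apply; exists [set z : full_shift A | z n = x n]; split => //.
  by exists [set x n] => //; exact: discrete_open.
suff : F --> (x : {ptws int -> discrete_topology A}) by [].
apply/cvg_sup => n U [V [[W oW <-] /= Wx] VU].
by apply: filterS (Fx n) => z /= zx; apply: VU => /=; rewrite zx.
Qed.

(** The cylinders around [x] generate a filter that converges to [x] coordinatewise, so it contains
    every neighbourhood of [x]. *)
Lemma nbhs_cylinder x U : nbhs x U -> exists N, cylinder x N `<=` U.
Proof.
pose F := filter_from setT (cylinder x).
have FF : Filter F.
  apply: filter_from_filter; first by exists 0%N.
  move=> i j _ _; exists (maxn i j) => // z zx.
  by split=> n nij; apply: zx; lia.
move=> xU; have /(_ U xU) [N _ NU] : F --> x; last by exists N.
by apply/full_shift_cvg => n; exists `|n|%N => // z /(_ n); apply; lia.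
Qed.

Lemma open_coord (n : int) (P : set A) : open [set x : full_shift A | P (x n)].
Proof.
rewrite openE => x /= Px; have /full_shift_cvg/(_ n) : nbhs x --> x by [].
by apply: filterS => z /= ->.
Qed.

Lemma measurable_open U : open U -> measurable U.
Proof. by move=> oU; exact: sub_sigma_algebra. Qed.

Lemma measurable_closed U : closed U -> measurable U.
Proof.
move=> cU; rewrite -[U]setCK; apply: measurableC; apply: measurable_open.
exact: closed_openC.
Qed.

Lemma measurable_coord (n : int) (P : set A) :
  measurable [set x : full_shift A | P (x n)].
Proof. by apply: measurable_open; exact: open_coord. Qed.

Lemma measurable_occurs_at u (i : int) :
  measurable [set x : full_shift A | occurs_at u x i].
Proof.
have -> : [set x : full_shift A | occurs_at u x i] = \bigcap_k
    [set x : full_shift A | (k < size u)%N -> nth point u k = x (i + k%:Z)].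
  apply/seteqP; split=> x /=.
    by move=> ux k _ /= ku; rewrite [in LHS]ux nth_mkseq.
  move=> ux; apply: (@eq_from_nth _ point); first by rewrite size_mkseq.
  by move=> k ku; rewrite nth_mkseq// ux.
apply: bigcapT_measurable => k.
exact: (measurable_coord _ [set a | (k < size u)%N -> nth point u k = a]).
Qed.

(** Openness survives only finite intersections, so the word is peeled off one letter at a time. *)
Lemma open_occurs_at u (i : int) :
  open [set x : full_shift A | occurs_at u x i].
Proof.
elim: u i => [|a u IH] i.
  by rewrite (_ : [set _ | _] = setT); [exact: openT|apply/seteqP; split].
have -> : [set x : full_shift A | occurs_at (a :: u) x i] =
    [set x | a = x i] `&` [set x | occurs_at u x (i + 1)].
  apply/seteqP; split => x /=; rewrite /occurs_at /= /mkseq/= addr0.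
    move=> [-> {1}->]; split=> //; rewrite -[1%N]/(1 + 0)%N iotaDl -map_comp.
    by apply: eq_map => k /=; rewrite -addrA.
  move=> [<- {1}->]; congr cons; rewrite -[1%N]/(1 + 0)%N iotaDl -map_comp.
  by apply: eq_map => k /=; rewrite -addrA.
by apply: openI => //; exact: (open_coord i [set b | a = b]).
Qed.

Lemma full_shift_compact : compact [set: full_shift A].
Proof.
have cA : compact [set: discrete_topology A].
  by apply: finite_compact; exact: (@finite_finset A).
have := @tychonoff _ (fun _ : int => discrete_topology A) _ (fun=> cA).
by congr (compact _); rewrite eqEsubset.
Qed.

Lemma full_shift_hausdorff : hausdorff_space (full_shift A).
Proof. by apply: hausdorff_product => ?; exact: discrete_hausdorff. Qed.

Lemma closed_compact U : closed U -> compact U.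
Proof.
by move=> cU; apply: (subclosed_compact cU full_shift_compact).
Qed.

End full_shift_topology.

(** * Doubly transitive points *)

Section shift_maps.
Local Open Scope ring_scope.
Variable A : alphabetType.
Implicit Types (x y : full_shift A) (X : set (full_shift A)) (u : seq A).

Lemma continuous_full_shift (T : topologicalType) (f : T -> full_shift A) :
  (forall t n, nbhs t [set s | f s n = f t n]) -> continuous f.
Proof. by move=> fn t; apply/full_shift_cvg => n; exact: fn. Qed.

Lemma continuous_measurable_full_shift (B : alphabetType)
    (f : full_shift A -> full_shift B) :
  continuous f -> measurable_fun setT f.
Proof.
move=> /continuousP cf.
apply: (measurability (@open (full_shift B))) => //.
move=> _ [U oU <-]; rewrite setTI; apply: measurable_open; exact: cf.
Qed.

Lemma nbhs_coord x (n : int) : nbhs x [set z : full_shift A | z n = x n].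
Proof. by apply: open_nbhs_nbhs; split=> //; exact: (open_coord n [set x n]). Qed.

Lemma occurs_at_left_shift u x (i : int) :
  occurs_at u (left_shift x) i = occurs_at u x (i + 1).
Proof.
rewrite /occurs_at /left_shift; congr (_ = mkseq _ _).
by apply/funext => k; rewrite addrAC.
Qed.

Lemma left_shift_inj : injective (@left_shift A).
Proof.
move=> x y xy; apply/funext => n.
by have := congr1 (fun z : full_shift A => z (n - 1)) xy; rewrite /left_shift subrK.
Qed.

Lemma shift_space_left_shift X x : shift_space X -> X (left_shift x) = X x.
Proof.
move=> [_ XE]; apply/propext; split=> [|Xx]; rewrite -{1}XE; last by exists x.
by move=> [y Xy /left_shift_inj <-].
Qed.

Lemma shift_space_measurable X : shift_space X -> measurable X.
Proof. by move=> [cX _]; exact: measurable_closed. Qed.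

End shift_maps.

(** Serves to read infinitude of a set of positions along a ray as the existence of arbitrarily
    large indices; the left inverse [g] carries finiteness back to [Q]. *)
Lemma infinite_image_natP (T : Type) (f : nat -> T) (g : T -> nat) (Q : set nat) :
  cancel f g ->
  infinite_set (f @` Q) <-> forall n, exists2 k, (n <= k)%N & Q k.
Proof.
move=> fK; split=> [iQ n|uQ /(finite_image g)].
  apply: contra_notP iQ => nQ; apply: finite_image.
  apply: (@sub_finite_set _ _ `I_n); last exact: finite_II.
  by move=> k Qk /=; rewrite ltnNge; apply/negP => nk; apply: nQ; exists k.
rewrite image_comp (_ : _ @` _ = Q) => [/finite_seqP[s Qs]|]; last first.
  by apply/seteqP; split=> [_ [k Qk <-]|k Qk]; [|exists k]; rewrite /= ?fK.
have [k sk Qk] := uQ (\max_(i <- s) i).+1.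
move: Qk; rewrite Qs /= => ks.
by have := @leq_bigmax_seq _ s predT id k ks isT; rewrite leqNgt sk.
Qed.

Section doubly_transitive_points.
Local Open Scope ring_scope.
Variables (A : alphabetType) (Y : set (full_shift A)).
Implicit Types (x y : full_shift A) (u : seq A) (s : bool).

(* [s] selects the direction: the k-th position to the right or to the left. *)
Definition ray s (k : nat) : int := if s then k%:Z else - k%:Z.
Arguments ray : simpl never.

Definition recurs u s (n : nat) : set (full_shift A) :=
  [set y | exists2 k, (n <= k)%N & occurs_at u y (ray s k)].

Lemma doubly_transitiveP y : doubly_transitive Y y <->
  Y y /\ forall u, language Y u -> forall s n, recurs u s n y.
Proof.
have rayK s : cancel (ray s) absz by move=> k; case: s; rewrite /ray ?abszN.
have recP u s : (forall n, recurs u s n y) <-> infinite_set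
    (ray s @` [set k | occurs_at u y (ray s k)]).
  exact: (iff_sym (infinite_image_natP _ (rayK s))).
have imN u : [set i : int | i <= 0 /\ occurs_at u y i] =
    ray false @` [set k | occurs_at u y (ray false k)].
  apply/seteqP; split=> [i /= [i0 ui]|_ [k /= uk <-]]; last by rewrite /ray; split=> //=; lia.
  have iE : ray false `|i|%N = i by rewrite /ray /=; lia.
  by exists `|i|%N; rewrite /= ?iE.
have imP u : [set i : int | 0 <= i /\ occurs_at u y i] =
    ray true @` [set k | occurs_at u y (ray true k)].
  apply/seteqP; split=> [i /= [i0 ui]|_ [k /= uk <-]]; last by split.
  have iE : ray true `|i|%N = i by rewrite /ray /=; lia.
  by exists `|i|%N; rewrite /= ?iE.
split=> -[Yy yu]; split=> // u uY.
  by case: (yu u uY); rewrite imN imP => ? ? [|]; apply/recP.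
by rewrite imN imP; split; apply/recP; exact: yu.
Qed.

Lemma measurable_recurs u s n : measurable (recurs u s n).
Proof.
have -> : recurs u s n = \bigcup_(k in [set k | (n <= k)%N])
    [set y | occurs_at u y (ray s k)].
  by apply/seteqP; split=> y [k nk uk]; exists k.
by apply: bigcup_measurable => k _; exact: measurable_occurs_at.
Qed.

(** Pairs of a word and a direction are countable, so Borel measurability and full measure can be
    checked one pair at a time. Membership in the language is kept as a premise so that the index
    runs over a whole countable type. *)
Lemma doubly_transitiveE : doubly_transitive Y = Y `&`
  \bigcap_(us : seq A * bool)
    [set y | language Y us.1 -> (\bigcap_n recurs us.1 us.2 n) y].
Proof.
apply/seteqP; split=> y.
  by move=> /doubly_transitiveP[Yy yu]; split=> // -[u s] _ /= uY n _; exact: yu.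
move=> [Yy yu]; apply/doubly_transitiveP; split=> // u uY s n.
exact: (yu (u, s)).
Qed.

End doubly_transitive_points.

(** * Sets of full probability and countable intersections *)

Section probability_full_sets.
Local Open Scope ereal_scope.
Context d (T : measurableType d) (R : realType) (P : probability T R).

Lemma probability_full_setC0 F : measurable F -> P F = 1 -> P (~` F) = 0.
Proof. by move=> mF PF; rewrite probability_setC// PF subee. Qed.

Lemma probability_full_setI E F : measurable E -> measurable F ->
  P F = 1 -> P (E `&` F) = P E.
Proof.
move=> mE mF PF; rewrite [RHS](measureDI P mE mF).
suff EF0 : P (E `\` F) = 0 by rewrite [X in X + _]EF0 add0e.
apply: (@subset_measure0 _ _ _ _ _ (~` F)) => //.
- exact: measurableD.
- exact: measurableC.
- exact: probability_full_setC0.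
Qed.

Lemma countable_bigcapT_measurable (I : countType) (F : I -> set T) :
  (forall i, measurable (F i)) -> measurable (\bigcap_i F i).
Proof.
move=> mF; rewrite -[X in measurable X]setCK setC_bigcap; apply: measurableC.
apply: countable_bigcupT_measurable => [|i]; first exact: countableP.
exact: measurableC.
Qed.

Lemma probability_full_bigcap (I : countType) (F : I -> set T) :
  (forall i, measurable (F i)) -> (forall i, P (F i) = 1) ->
  P (\bigcap_i F i) = 1.
Proof.
move=> mF PF; have mcap := countable_bigcapT_measurable mF.
rewrite -[X in P X]setCK probability_setC; last exact: measurableC.
suff -> : P (~` \bigcap_i F i) = 0 by rewrite sube0.
apply: measure_negligible; first exact: measurableC.
(* Reindexes the complements by natural numbers; codes that decode to nothing contribute the empty
   set. *)
pose G n := if unpickle n is Some i then ~` F i else set0.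
apply: (@negligibleS _ _ _ _ (\bigcup_n G n)).
  rewrite setC_bigcap => t [i _ Fit]; exists (pickle i) => //.
  by rewrite /G pickleK.
apply: negligible_bigcup => n; rewrite /G; case: unpickle => [i|]; last first.
  exact: negligible_set0.
by apply/negligibleP; [exact: measurableC|exact: probability_full_setC0].
Qed.

End probability_full_sets.

(** * Almost every point is doubly transitive *)

Section doubly_transitive_full.
Local Open Scope ereal_scope.
Variables (R : realType) (A : alphabetType) (Y : set (full_shift A)).
Variable nu : probability (full_shift A) R.
Hypotheses (Y_shift : shift_space Y) (nu_Y : measure_on Y nu).
Hypotheses (nu_full : fully_supported Y nu) (nu_inv : shift_invariant nu).
Hypothesis nu_erg : ergodic Y nu.

Let mY : measurable Y := shift_space_measurable Y_shift.

Lemma measure_occurs_at u (i : int) :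
  nu [set y | occurs_at u y i] = nu [set y | occurs_at u y 0%R].
Proof.
have step j : nu [set y | occurs_at u y (j + 1)%R] = nu [set y | occurs_at u y j].
  rewrite -(nu_inv (measurable_occurs_at u j)); congr (nu _).
  by apply/funext => y /=; rewrite occurs_at_left_shift.
elim: i => [//|k IH|k IH]; first by rewrite -addn1 PoszD step.
by rewrite -step -addn1 PoszD opprD addrNK.
Qed.

(** A point of Y shows [u] at some position j, so full support gives positive measure there, and
    invariance moves j to [i]. *)
Lemma measure_occurs_at_gt0 u (i : int) : language Y u ->
  0 < nu [set y | occurs_at u y i].
Proof.
move=> [x Yx [j xj]]; rewrite measure_occurs_at -(measure_occurs_at u j).
have mu := measurable_occurs_at u j.
rewrite -(probability_full_setI mu mY nu_Y); apply: nu_full.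
  exact: open_occurs_at.
by exists x.
Qed.

(* The sets [recurs u s n] decrease with n and are shifts of one another, so
   their intersection is invariant and as large as [recurs u s 0]. *)
Lemma measure_bigcap_recurs u s : language Y u ->
  nu (\bigcap_n recurs u s n) = 1.
Proof.
move=> uY; have mr := measurable_recurs u s.
have mcap : measurable (\bigcap_n recurs u s n) by exact: bigcapT_measurable.
have rS n : recurs u s n.+1 `<=` recurs u s n.
  by move=> y [k nk uk]; exists k => //; exact: ltnW.
have rle : {homo recurs u s : m n / (m <= n)%N >-> n `<=` m}.
  by move=> m n mn y [k nk uk]; exists k => //; exact: leq_trans nk.
(* The left shift brings position k + 1 to k. Taking the preimage therefore pushes the bound
   outwards on the right ray and inwards on the left ray. *)
have shift_recurs n : if s
    then @left_shift A @^-1` recurs u s n = recurs u s n.+1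
    else @left_shift A @^-1` recurs u s n.+1 = recurs u s n.
  case: s {mr mcap rS rle} => /=; apply/seteqP; split=> y [k nk] /=.
  - by rewrite occurs_at_left_shift => uk; exists k.+1; rewrite //= -addn1 PoszD.
  - case: k nk => // k nk; rewrite /= -addn1 PoszD => uk.
    by exists k => //; rewrite occurs_at_left_shift.
  - case: k nk => // k nk; rewrite occurs_at_left_shift /= => uk.
    by exists k => //=; rewrite -(_ : (- k.+1%:Z + 1 = - k%:Z)%R)//; lia.
  - move=> uk; exists k.+1 => //; rewrite occurs_at_left_shift /=.
    by rewrite (_ : (- k.+1%:Z + 1 = - k%:Z)%R)//; lia.
have shift_cap :
    @left_shift A @^-1` (\bigcap_n recurs u s n) = \bigcap_n recurs u s n.
  rewrite preimage_bigcap; apply/seteqP; split=> y yr n _.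
    case: s shift_recurs yr {mr mcap rle} rS => /= sr yr rS.
      by apply: rS; rewrite -sr; exact: yr.
    by rewrite -sr; exact: yr.
  case: s shift_recurs yr {mr mcap rle} rS => /= sr yr rS.
    by have [_] := (seteqP _ _).1 (sr n); apply; exact: yr.
  by have [_] := (seteqP _ _).1 (sr n); move/(_ y (yr n I)) => /rS.
have nuS n : nu (recurs u s n.+1) = nu (recurs u s n).
  case: s shift_recurs mr {mcap rle shift_cap rS} => /= sr mr.
    by rewrite -sr; exact: nu_inv.
  by rewrite -(sr n); exact/esym/nu_inv.
have nu0 n : nu (recurs u s n) = nu (recurs u s 0).
  by elim: n => // n <-; exact: nuS.
(* Continuity from above along a decreasing sequence whose measures are all equal. *)
have capE : nu (\bigcap_n recurs u s n) = nu (recurs u s 0).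
  have lt_oo : nu (recurs u s 0) < +oo by rewrite ltey_eq fin_num_measure.
  have ni : nonincreasing_seq (recurs u s).
    by move=> m n mn; apply/subsetPset; exact: rle.
  have := nonincreasing_cvg_mu lt_oo mr mcap ni.
  rewrite (_ : nu \o recurs u s = cst (nu (recurs u s 0))); last exact/funext.
  by move=> /cvg_lim <-//; rewrite lim_cst.
have cap_gt0 : 0 < nu (\bigcap_n recurs u s n).
  rewrite capE; apply: (lt_le_trans (measure_occurs_at_gt0 (ray s 0) uY)).
  apply: le_measure; rewrite ?inE//; first exact: measurable_occurs_at.
  by move=> y uy; exists 0%N.
(* [ergodic] speaks of subsets of Y, so the intersection is cut down to Y at no cost in measure. *)
rewrite -(probability_full_setI mcap mY nu_Y) in cap_gt0 *.
have [||cap0|//] := nu_erg (measurableI _ _ mcap mY).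
- by move=> y [].
- by rewrite preimage_setI shift_cap; congr setI; apply/funext => y /=;
    rewrite shift_space_left_shift.
- by rewrite cap0 ltxx in cap_gt0.
Qed.

Let mF (us : seq A * bool) : measurable
  [set y | language Y us.1 -> (\bigcap_n recurs us.1 us.2 n) y].
Proof.
have [uY|uY] := pselect (language Y us.1).
  rewrite (_ : [set y | _] = \bigcap_n recurs us.1 us.2 n).
    by apply: bigcapT_measurable => n; exact: measurable_recurs.
  by apply/seteqP; split=> y; [exact|move=> ? _].
by rewrite (_ : [set y | _] = setT)//; apply/seteqP; split=> // y _ /uY.
Qed.

Lemma measurable_doubly_transitive : measurable (doubly_transitive Y).
Proof.
rewrite doubly_transitiveE; apply: measurableI => //.
exact: countable_bigcapT_measurable.
Qed.

Lemma measure_doubly_transitive : nu (doubly_transitive Y) = 1.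
Proof.
rewrite doubly_transitiveE setIC probability_full_setI//; last first.
  exact: countable_bigcapT_measurable.
apply: probability_full_bigcap => // -[u s] /=.
have [uY|uY] := pselect (language Y u).
  rewrite -(measure_bigcap_recurs s uY); congr (nu _).
  by apply/seteqP; split=> y; [exact|move=> ? _].
rewrite -(probability_setT nu); congr (nu _).
by apply/seteqP; split=> // y _ /uY.
Qed.

End doubly_transitive_full.

(** * The Gibbs relation *)

Section gibbs_relation.
Local Open Scope ring_scope.
Variables (A : alphabetType) (X : set (full_shift A)).
Implicit Types (x y z : full_shift A) (w : seq A) (E : set (full_shift A)).

(** Countably many continuous maps that reach every point Gibbs-related to [x]: the window from -N
    to N is overwritten by [w], padded with [point] if [w] is short. *)
Definition splice (N : nat) w x : full_shift A :=
  fun n => if `|n| <= N%:Z then nth point w (absz (n + N%:Z)) else x n.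

Lemma measurable_splice N w : measurable_fun setT (splice N w).
Proof.
apply: continuous_measurable_full_shift; apply: continuous_full_shift => x n.
rewrite /splice; case: ifP => nN; last exact: nbhs_coord.
by rewrite (_ : [set _ | _] = setT); [exact: filterT|apply/seteqP; split].
Qed.

(* Writes the saturation as a countable union: a point of it is related to
   a point of E that is obtained by changing finitely many coordinates. *)
Lemma saturationE E : saturation X E = X `&`
  \bigcup_(Nw : nat * seq A) splice Nw.1 Nw.2 @^-1` (E `&` X).
Proof.
apply/seteqP; split=> [x' [x Ex [/= Xx Xx' [N N1 xx']]]|x' [Xx' [[N w] _ /=]]].
  (* The word is the window of [x] of length 2N + 1; written into [x'] it gives back [x]. *)
  split=> //; exists (N, mkseq (fun k => x (k%:Z - N%:Z)) (N + N).+1) => //=.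
  rewrite (_ : splice _ _ _ = x)//; apply/funext => n; rewrite /splice.
  case: ifPn => nN; last by rewrite xx' // ltNge.
  by rewrite nth_mkseq; [congr x; lia|lia].
move=> [Ew Xw]; exists (splice N w x') => //; split=> //=.
(* The successor meets the demand of [gibbs_rel] for a bound of at least 1. *)
exists N.+1 => // n nN; rewrite /splice ifF//; lia.
Qed.

Lemma measurable_saturation E : measurable X -> measurable E ->
  measurable (saturation X E).
Proof.
move=> mX mE; rewrite saturationE; apply: measurableI => //.
apply: countable_bigcupT_measurable => [|[N w]]; first exact: countableP.
rewrite -[X in measurable X]setTI; apply: measurable_splice => //.
exact: measurableI.
Qed.

Lemma measurable_gibbs_rel : measurable X -> measurable (gibbs_rel X).
Proof.
move=> mX.
have -> : gibbs_rel X = (X `*` X) `&` \bigcup_(N in [set N | (1 <= N)%N])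
    \bigcap_(n : int) [set p | N%:Z < `|n| -> p.1 n = p.2 n].
  apply/seteqP; split=> [p [Xp1 Xp2 [N N1 pN]]|p [[Xp1 Xp2] [N N1 pN]]].
    by split=> //; exists N => // n _; exact: pN.
  by split=> //; exists N => // n; exact: pN.
apply: measurableI; first exact: measurableX.
apply: bigcup_measurable => N _; apply: countable_bigcapT_measurable => n.
have [nN|nN] := ltP N%:Z `|n|; last first.
  by rewrite (_ : [set _ | _] = setT)//; apply/seteqP; split.
(* Equality of one coordinate is a union of rectangles over the letters, hence lies in the product
   sigma-algebra. *)
rewrite (_ : [set _ | _] = \bigcup_(a : A)
    ([set x : full_shift A | x n = a] `*` [set x : full_shift A | x n = a])).
  apply: countable_bigcupT_measurable => [|a]; first exact: countableP.
  by apply: measurableX; exact: (measurable_coord n [set a]).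
apply/seteqP; split=> [p /= pn|p [a _ [/= -> ->]]//].
by exists (p.1 n) => //; split => //=; rewrite pn.
Qed.

Lemma doubly_transitive_gibbs_rel y z :
  gibbs_rel X (y, z) -> doubly_transitive X y -> doubly_transitive X z.
Proof.
move=> [/= _ Xz [N _ yz]] /doubly_transitiveP[_ yu].
apply/doubly_transitiveP; split=> // u uX s n.
(* So far out, every letter of the occurrence lies outside the window where [y] and [z] may differ,
   even on the left ray, where the word extends back towards the origin. *)
have [k nk uk] := yu u uX s (n + N + size u).+1.
exists k; first by lia.
rewrite /occurs_at [LHS]uk; apply/eq_in_map => j; rewrite mem_iota => ju.
by apply: yz; rewrite /ray; case: s {uk}; lia.
Qed.

End gibbs_relation.

(** * Factor codes are sliding block codes *)

Section codes.
Local Open Scope ring_scope.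
Variables (A B : alphabetType).
Variables (X : set (full_shift A)) (Y : set (full_shift B)).
Variable pi : full_shift A -> full_shift B.
Implicit Types (x : full_shift A).

Lemma cylinder_nbhs x N : nbhs x (cylinder x N).
Proof.
elim: N => [|N IH].
  by apply: filterS (nbhs_coord x 0) => z /= z0 n n0; rewrite (_ : n = 0)//; lia.
apply: filterS (filterI IH (filterI (nbhs_coord x N.+1%:Z)
  (nbhs_coord x (- N.+1%:Z)))) => z [zN [/= zp zn]] n nN.
have [nN'|nN'] := leP `|n| N%:Z; first exact: zN.
have [->//|->//] : n = N.+1%:Z \/ n = - N.+1%:Z by lia.
Qed.

(** The Curtis-Hedlund-Lyndon argument at coordinate 0: continuity gives a window around each point,
    and compactness of X makes its radius uniform. *)
Lemma continuous_local_rule : closed X -> {within X, continuous pi} ->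
  exists N, forall x z, X x -> X z -> cylinder x N z -> pi z 0 = pi x 0.
Proof.
move=> cX /subspace_continuousP cpi.
have := (compact_near_coveringP X).1 (closed_compact cX) nat \oo
  (fun N x => X x -> forall z, X z -> cylinder x N z -> pi z 0 = pi x 0).
case=> [|N _ XN]; last by exists N => x z Xx; exact: (XN N (leqnn N) x Xx Xx).
(* If M works at [x], then for [x'] near [x] and N at least M both [x'] and [z] lie in the cylinder
   of radius M around [x], so both images are compared with [pi x]. *)
move=> x Xx; have := cpi x Xx _ (nbhs_coord (pi x) 0).
move=> /nbhs_cylinder[M xM]; near=> x' N => Xx' z Xz x'z.
have x'M : cylinder x M x' by near: x'; exact: cylinder_nbhs.
have MN : (M <= N)%N by near: N; exact: nbhs_infty_ge.
have -> : pi x' 0 = pi x 0 by exact: xM.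
apply: xM => // n nM; rewrite x'z /= ?x'M//.
by rewrite (le_trans nM)// lez_nat.
Unshelve. all: by end_near.
Qed.

Hypothesis pi_code : factor_code X Y pi.

Lemma factor_code_gibbs_rel x z :
  gibbs_rel X (x, z) -> gibbs_rel Y (pi x, pi z).
Proof.
have [X_shift _ cpi pi_shift piXY] := pi_code.
have [N piN] := continuous_local_rule X_shift.1 cpi.
have rule (n : int) : forall x z, X x -> X z ->
    (forall m : int, `|m - n| <= N%:Z -> z m = x m) -> pi z n = pi x n.
  have rule_shift k : (forall x z, X x -> X z ->
    (forall m : int, `|m - k| <= N%:Z -> z m = x m) -> pi z k = pi x k) ->
    forall x z, X x -> X z ->
    (forall m : int, `|m - (k + 1)| <= N%:Z -> z m = x m) -> pi z (k + 1) = pi x (k + 1).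
    move=> IH x1 z1 Xx1 Xz1 xz1.
    have := IH (left_shift x1) (left_shift z1).
    rewrite !pi_shift// {3 4}/left_shift; apply.
    - by rewrite shift_space_left_shift.
    - by rewrite shift_space_left_shift.
    - by move=> m mk; apply: xz1; lia.
  elim: n => [|n IH|n IH].
  - move=> x1 z1 Xx1 Xz1 xz1; apply: piN => // m mN; apply: xz1; lia.
  - by rewrite -addn1 PoszD; exact: rule_shift.
  (* Towards negative coordinates the induction runs backwards, so both points are written as left
     shifts of points of X. *)
  - move=> x1 z1; have [_ XE] := X_shift; rewrite -{1 2}XE.
    move=> [x2 Xx2 <-] [z2 Xz2 <-] xz; rewrite !pi_shift// /left_shift.
    rewrite (_ : - n.+1%:Z + 1 = - n%:Z); last lia.
    apply: IH => // m mn; have := xz (m - 1).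
    by rewrite /left_shift subrK; apply; lia.
move=> [/= Xx Xz [M M1 xzM]]; split; rewrite -?piXY; [by exists x|by exists z|].
(* Beyond M + N, a window of radius N misses the coordinates where the points may differ. *)
exists (M + N)%N; first lia.
by move=> n nMN; apply/esym/rule => // m mn; apply/esym/xzM; lia.
Qed.

End codes.

(** * Inverting an almost invertible code *)

Section measurable_codes.
Variables (A B : alphabetType).
Variables (X : set (full_shift A)) (Y : set (full_shift B)).
Variable pi : full_shift A -> full_shift B.
Hypothesis pi_code : factor_code X Y pi.

Let X_shift : shift_space X. Proof. by case: pi_code. Qed.
Let mX : measurable X. Proof. exact: shift_space_measurable. Qed.
Let pi_cont : {within X, continuous pi}. Proof. by case: pi_code. Qed.

Lemma factor_code_image x : X x -> Y (pi x).
Proof. by case: pi_code => _ _ _ _ <- Xx; exists x. Qed.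

Lemma measurable_factor_code : measurable_fun X pi.
Proof.
apply: (measurability (@open (full_shift B))) => //.
move=> _ [U oU <-]; move/continuousP : pi_cont => /(_ U oU) /open_subspaceP[V oV VX].
rewrite setIC [X in measurable X](_ : _ = V `&` X).
  by apply: measurableI => //; exact: measurable_open.
exact/esym.
Qed.

(* Makes [pi] a globally defined Borel map, its values outside X being junk. *)
Definition code_ext (x : full_shift A) : full_shift B :=
  if x \in X then pi x else point.

Lemma code_extE x : X x -> code_ext x = pi x.
Proof. by move=> Xx; rewrite /code_ext mem_set. Qed.

Lemma measurable_code_ext : measurable_fun setT code_ext.
Proof.
move=> _ E mE; rewrite setTI.
have -> : code_ext @^-1` E =
    (X `&` pi @^-1` E) `|` (~` X `&` [set _ | E point]).
  apply/seteqP; split=> x /=; rewrite /code_ext.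
    by have [Xx|Xx] := pselect (X x); [rewrite mem_set//; left|
      rewrite memNset//; right].
  by move=> [[Xx]|[Xx]]; [rewrite mem_set|rewrite memNset].
apply: measurableU; first exact: measurable_factor_code.
apply: measurableI; first exact: measurableC.
have [Ep|Ep] := pselect (E point).
  by rewrite (_ : [set _ | _] = setT)//; apply/seteqP; split.
by rewrite (_ : [set _ | _] = set0)//; apply/seteqP; split.
Qed.

Lemma cocycle_factor_code (R : realType) (phi : full_shift B * full_shift B -> R) :
  cocycle Y phi -> cocycle X (fun p => phi (pi p.1, pi p.2)).
Proof.
move=> [mphi phiD]; split=> [|x y z xy yz]; last first.
  by apply: phiD; exact: (factor_code_gibbs_rel pi_code).
have mY : measurable Y by apply: shift_space_measurable; case: pi_code.
(* On [gibbs_rel X] the globally Borel [code_ext] may replace [pi]. *)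
apply: (@eq_measurable_fun _ _ _ _ _
    (phi \o (fun p => (code_ext p.1, code_ext p.2)))).
  by move=> p /set_mem[/= Xp1 Xp2 _]; rewrite /= !code_extE.
apply: (measurable_comp (measurable_gibbs_rel mY)) => //.
  move=> _ [p [Xp1 Xp2 p12] <-]; rewrite !code_extE//.
  exact: (factor_code_gibbs_rel pi_code).
apply: measurable_funTS; apply: measurable_fun_pair.
  by apply: measurableT_comp measurable_fst; exact: measurable_code_ext.
by apply: measurableT_comp measurable_snd; exact: measurable_code_ext.
Qed.

Hypothesis pi_ai : almost_invertible X Y pi.

(** By almost invertibility, [pi] maps this set bijectively onto the doubly transitive points of
    Y. *)
Definition regular_points : set (full_shift A) :=
  X `&` pi @^-1` doubly_transitive Y.

Definition code_inv (y : full_shift B) : full_shift A :=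
  xget point [set x | X x /\ pi x = y].

Lemma code_invP y : doubly_transitive Y y ->
  regular_points (code_inv y) /\ pi (code_inv y) = y.
Proof.
move=> dy; have [x [xP _]] := pi_ai dy.
have [Xy yE] : [set x | X x /\ pi x = y] (code_inv y).
  by apply: xgetPex; exists x.
by split=> //; split=> //; rewrite /preimage/= yE.
Qed.

Lemma code_invK x : regular_points x -> code_inv (pi x) = x.
Proof.
move=> [Xx dx]; have [[Xy _] yE] := code_invP dx.
by have [z [_ zP]] := pi_ai dx; rewrite -(zP _ (conj Xy yE)); exact: zP.
Qed.

(** By uniqueness of preimages, the inverse sends [y] into an open U exactly when [y] is not in the
    image of the rest of X, and that image is compact, hence closed. *)
Lemma measurable_code_inv : measurable (doubly_transitive Y) ->
  measurable_fun (doubly_transitive Y) code_inv.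
Proof.
move=> mdY; apply: (measurability (@open (full_shift A))) => //.
move=> _ [U oU <-].
have -> : doubly_transitive Y `&` code_inv @^-1` U =
    doubly_transitive Y `\` pi @` (X `&` ~` U).
  apply/seteqP; split=> y [dy]; have [[Xy _] yE] := code_invP dy.
    move=> Uy; split=> // -[x [Xx Ux] xy]; apply: Ux.
    by rewrite -(code_invK (x := x)) ?xy//; split=> //; rewrite /preimage/= xy.
  move=> yU; split=> //; apply: contrapT => Uy; apply: yU.
  by exists (code_inv y).
apply: measurableD => //; apply: measurable_closed.
apply: compact_closed; first exact: full_shift_hausdorff.
apply: continuous_compact; first by apply: continuous_subspaceW pi_cont => x [].
apply: closed_compact; apply: closedI; first exact: X_shift.1.
exact: open_closedC.
Qed.

Lemma image_regular_points E : pi @` (E `&` regular_points) =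
  doubly_transitive Y `&` code_inv @^-1` E.
Proof.
apply/seteqP; split=> [_ [x [Ex rx] <-]|y [dy /= Ey]].
  by split; [exact: rx.2|rewrite /preimage/= code_invK].
by have [ry yE] := code_invP dy; exists (code_inv y).
Qed.

(** No point of X outside [E] lies over the image, which lets the [mu]-measure of [E] be computed as
    the [nu]-measure of an image. *)
Lemma preimage_image_regular_points E :
  X `&` pi @^-1` (pi @` (E `&` regular_points)) = E `&` regular_points.
Proof.
rewrite image_regular_points; apply/seteqP; split=> [x [Xx [dx /=]]|x [Ex rx]].
  by rewrite code_invK.
by split; [exact: rx.1|split; [exact: rx.2|rewrite /= code_invK]].
Qed.

Lemma regular_points_gibbs_rel x z :
  gibbs_rel X (x, z) -> regular_points x -> regular_points z.
Proof.
move=> xz [Xx dx]; split; first by case: xz.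
exact: doubly_transitive_gibbs_rel (factor_code_gibbs_rel pi_code xz) dx.
Qed.

End measurable_codes.

Lemma gibbs_rel_sym (A : alphabetType) (X : set (full_shift A)) x y :
  gibbs_rel X (x, y) -> gibbs_rel X (y, x).
Proof.
move=> [/= Xx Xy [N N1 xy]]; split=> //; exists N => // n nN.
exact/esym/xy.
Qed.

(** * Transporting holonomies from X to Y *)

Section holonomy_transport.
Variables (A B : alphabetType).
Variables (X : set (full_shift A)) (Y : set (full_shift B)).
Variable pi : full_shift A -> full_shift B.
Hypotheses (pi_code : factor_code X Y pi) (pi_ai : almost_invertible X Y pi).
Hypothesis mdY : measurable (doubly_transitive Y).
Variable psi : holonomy X.

Let r := code_inv X pi.
Let mr : measurable_fun (doubly_transitive Y) r.
Proof. exact: (measurable_code_inv pi_code). Qed.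

Lemma regular_points_hol_fun x : hol_dom psi x ->
  regular_points X Y pi x -> regular_points X Y pi (hol_fun psi x).
Proof.
by move=> /hol_gibbs_rel xy; exact: (regular_points_gibbs_rel pi_code xy).
Qed.

Lemma regular_points_hol_inv y : hol_cod psi y ->
  regular_points X Y pi y -> regular_points X Y pi (hol_inv psi y).
Proof.
move=> cy; apply: (regular_points_gibbs_rel pi_code); apply: gibbs_rel_sym.
by have /hol_gibbs_rel := hol_invP cy; rewrite hol_invK.
Qed.

Let dom := doubly_transitive Y `&` r @^-1` hol_dom psi.
Let cod := doubly_transitive Y `&` r @^-1` hol_cod psi.
Let fwd := pi \o hol_fun psi \o r.
Let bwd := pi \o hol_inv psi \o r.

Let mdom : measurable dom. Proof. by apply: mr => //; exact: measurable_hol_dom. Qed.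
Let mcod : measurable cod. Proof. by apply: mr => //; exact: measurable_hol_cod. Qed.

Let dom_sub : dom `<=` Y. Proof. by move=> y [[]]. Qed.
Let cod_sub : cod `<=` Y. Proof. by move=> y [[]]. Qed.

Let fwdE y : dom y -> regular_points X Y pi (hol_fun psi (r y)).
Proof.
by move=> [dy ry]; apply: regular_points_hol_fun => //; have [] := code_invP pi_ai dy.
Qed.

Let bwdE y : cod y -> regular_points X Y pi (hol_inv psi (r y)).
Proof.
by move=> [dy ry]; apply: regular_points_hol_inv => //; have [] := code_invP pi_ai dy.
Qed.

Let fwdP y : dom y -> cod (fwd y).
Proof.
move=> /[dup] /fwdE ry [dy yD]; split; first exact: ry.2.
by rewrite /preimage/= /r (code_invK pi_ai ry); exact: hol_funP.
Qed.

Let bwdP y : cod y -> dom (bwd y).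
Proof.
move=> /[dup] /bwdE ry [dy yD]; split; first exact: ry.2.
by rewrite /preimage/= /r (code_invK pi_ai ry); exact: hol_invP.
Qed.

Let fwdK y : dom y -> bwd (fwd y) = y.
Proof.
move=> /[dup] /fwdE ry [dy yD]; rewrite /bwd /fwd /= /r (code_invK pi_ai ry).
by rewrite hol_funK//; have [] := code_invP pi_ai dy.
Qed.

Let bwdK y : cod y -> fwd (bwd y) = y.
Proof.
move=> /[dup] /bwdE ry [dy yD]; rewrite /bwd /fwd /= /r (code_invK pi_ai ry).
by rewrite hol_invK//; have [] := code_invP pi_ai dy.
Qed.

Let mX : measurable X.
Proof. by apply: shift_space_measurable; case: pi_code. Qed.

Let mfwd : measurable_fun dom fwd.
Proof.
apply: (measurable_comp mX _ (measurable_factor_code pi_code)).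
  by move=> _ [y /fwdE[]] + _ <-.
apply: (measurable_comp (measurable_hol_dom psi) _ (@measurable_hol_fun _ _ psi)).
  by move=> _ [y [_ ry] <-].
by apply: measurable_funS mr => // y [].
Qed.

Let mbwd : measurable_fun cod bwd.
Proof.
apply: (measurable_comp mX _ (measurable_factor_code pi_code)).
  by move=> _ [y /bwdE[]] + _ <-.
apply: (measurable_comp (measurable_hol_cod psi) _ (@measurable_hol_inv _ _ psi)).
  by move=> _ [y [_ ry] <-].
by apply: measurable_funS mr => // y [].
Qed.

Let fwd_gibbs y : dom y -> gibbs_rel Y (y, fwd y).
Proof.
(* Only the bare [y] is rewritten as the image of [r y], so that the relation becomes the image
   under [pi] of one in X. *)
move=> [dy /hol_gibbs_rel]; have [_ {3}<-] := code_invP pi_ai dy.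
exact: (factor_code_gibbs_rel pi_code).
Qed.

(** The conjugate of [psi] by [pi], confined to doubly transitive points, where [pi] has the Borel
    inverse [r]. Regular points are closed under the Gibbs relation, so neither direction leaves
    this domain. *)
Definition transport_holonomy : holonomy Y :=
  Holonomy mdom mcod dom_sub cod_sub fwdP bwdP fwdK bwdK mfwd mbwd fwd_gibbs.

Lemma transport_holonomy_domE :
  hol_dom transport_holonomy = doubly_transitive Y `&` r @^-1` hol_dom psi.
Proof. by []. Qed.

Lemma transport_holonomy_fun x : regular_points X Y pi x ->
  hol_fun transport_holonomy (pi x) = pi (hol_fun psi x).
Proof. by move=> rx; rewrite /= /fwd /= /r (code_invK pi_ai rx). Qed.

Lemma transport_holonomy_image E :
  hol_fun transport_holonomy @`
    (pi @` (E `&` regular_points X Y pi) `&` hol_dom transport_holonomy) =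
  pi @` (hol_fun psi @` (E `&` hol_dom psi) `&` regular_points X Y pi).
Proof.
apply/seteqP; split=> [_ [_ [[x [Ex rx] <-] [_ xD]] <-]|].
  have {}xD : hol_dom psi x by move: xD; rewrite /preimage/= /r (code_invK pi_ai rx).
  rewrite transport_holonomy_fun//; exists (hol_fun psi x) => //.
  by split; [exists x|exact: regular_points_hol_fun].
move=> _ [_ [[x [Ex xD] <-] rx] <-].
(* Regularity is known for the image of [x]; it is pulled back through the inverse of [psi]. *)
have {}rx : regular_points X Y pi x.
  by rewrite -(hol_funK xD); apply: regular_points_hol_inv => //; exact: hol_funP.
exists (pi x); last exact: transport_holonomy_fun.
split; first by exists x.
by split; [exact: rx.2|rewrite /preimage/= /r (code_invK pi_ai rx)].
Qed.

End holonomy_transport.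

(** * Lifting Gibbs measures *)

Section integral_measure_preserving.
Local Open Scope ring_scope.
Local Open Scope ereal_scope.
Context d1 d2 (T1 : measurableType d1) (T2 : measurableType d2) (R : realType).
Variables (mu : {measure set T1 -> \bar R}) (nu : {measure set T2 -> \bar R}).
Variable f : T1 -> T2.
Hypothesis mf : measurable_fun setT f.
Hypothesis f_mu : forall E, measurable E -> mu (f @^-1` E) = nu E.
Variable h : T2 -> \bar R.
Hypothesis int_h : nu.-integrable setT h.

Let mh : measurable_fun setT h. Proof. by have /integrableP[] := int_h. Qed.

(** The pushforward of [mu] along [f] agrees with [nu] on measurable sets, so change of variables
    applies. *)
Lemma integrable_measure_preserving : mu.-integrable setT (h \o f).
Proof.
apply/integrableP; split; first exact: measurableT_comp.
have /integrableP[_] := int_h; congr (_ < _).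
rewrite -(@eq_measure_integral _ _ _ _ _ (pushforward mu f)).
  rewrite ge0_integral_pushforward//.
  exact: measurableT_comp.
by move=> E mE _; exact: f_mu.
Qed.

Lemma integral_measure_preserving E : measurable E ->
  \int[nu]_(y in E) h y = \int[mu]_(x in f @^-1` E) h (f x).
Proof.
move=> mE; rewrite -(@eq_measure_integral _ _ _ _ _ (pushforward mu f)); last first.
  by move=> F mF _; exact: f_mu.
rewrite integral_pushforward//.
apply: integrableS integrable_measure_preserving => //.
by rewrite -[X in measurable X]setTI; exact: mf.
Qed.

End integral_measure_preserving.

(** A holonomy maps a null set into its saturation, which is null. *)
Lemma nonsingular_dominates (R : realType) (A : alphabetType)
    (X : set (full_shift A)) (mu : probability (full_shift A) R)
    (psi : holonomy X) :
  measurable X -> nonsingular X mu -> holonomy_measure mu psi `<< mu.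
Proof.
move=> mX mu_ns; apply/null_content_dominatesP => E mE mu0.
have mED : measurable (E `&` hol_dom psi).
  by apply: measurableI => //; exact: measurable_hol_dom.
have mu_sat : mu (saturation X (E `&` hol_dom psi)) = 0%E.
  apply: mu_ns => //; first by move=> x [_ /hol_dom_sub].
  by apply: subset_measure0 mu0 => //; exact: measurable_hol_dom.
rewrite /holonomy_measure; apply: subset_measure0 mu_sat.
- rewrite Defs.holonomy_imageE; apply: measurable_hol_inv => //.
  exact: measurable_hol_cod.
- exact: measurable_saturation.
- by move=> _ [x [Ex xD] <-]; exists x => //; exact: hol_gibbs_rel.
Qed.

Section lift_measure.
Local Open Scope ring_scope.
Local Open Scope ereal_scope.
Local Open Scope charge_scope.
Variables (R : realType) (A B : alphabetType).
Variables (X : set (full_shift A)) (Y : set (full_shift B)).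
Variable pi : full_shift A -> full_shift B.
Hypotheses (pi_code : factor_code X Y pi) (pi_ai : almost_invertible X Y pi).
Variables (nu : probability (full_shift B) R) (mu : probability (full_shift A) R).
Hypothesis mdY : measurable (doubly_transitive Y).
Hypothesis nu_dY : nu (doubly_transitive Y) = 1.
Hypothesis mu_X : measure_on X mu.
Hypothesis pi_mu : forall E, measurable E -> mu (X `&` pi @^-1` E) = nu E.

Let X0 := regular_points X Y pi.
Let mX : measurable X.
Proof. by apply: shift_space_measurable; case: pi_code. Qed.
Let mY : measurable Y.
Proof. by apply: shift_space_measurable; case: pi_code. Qed.

Let mX0 : measurable X0.
Proof. exact: (measurable_factor_code pi_code). Qed.

Let mu_X0 : mu X0 = 1. Proof. by rewrite pi_mu. Qed.

Let measurable_image E : measurable E -> measurable (pi @` (E `&` X0)).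
Proof.
by move=> mE; rewrite image_regular_points//; exact: (measurable_code_inv pi_code).
Qed.

(** Since [mu] lives on the regular points, it is determined by [nu] through the inverse of [pi]. *)
Lemma measure_image_regular_points E : measurable E ->
  nu (pi @` (E `&` X0)) = mu E.
Proof.
move=> mE; rewrite -pi_mu; last exact: measurable_image.
by rewrite preimage_image_regular_points// probability_full_setI.
Qed.

(** A regular point related to some x in [E] forces x to be regular. Hence, up to a null set, the
    saturation of [E] lies over the saturation of the null image of [E]. *)
Lemma lift_nonsingular : nonsingular Y nu -> nonsingular X mu.
Proof.
move=> nu_ns E mE EX mu0; have mpE := measurable_image mE.
have msat : measurable (saturation Y (pi @` (E `&` X0))).
  exact: measurable_saturation.
have nu_sat : nu (saturation Y (pi @` (E `&` X0))) = 0.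
  apply: nu_ns => //; last by rewrite measure_image_regular_points.
  by move=> _ [x [/EX Xx _] <-]; exact: (factor_code_image pi_code).
have mS := measurable_saturation mX mE.
rewrite -(probability_full_setI mS mX0 mu_X0).
rewrite -(pi_mu msat) in nu_sat; apply: subset_measure0 nu_sat.
- exact: measurableI.
- exact: (measurable_factor_code pi_code).
move=> z [[x Ex xz] z0]; split; first exact: z0.1.
exists (pi x); last exact: (factor_code_gibbs_rel pi_code).
exists x => //; split=> //.
by apply: (regular_points_gibbs_rel pi_code) z0; exact: gibbs_rel_sym.
Qed.

Let ext_mu E : measurable E -> mu (code_ext X pi @^-1` E) = nu E.
Proof.
move=> mE; rewrite -pi_mu// -(probability_full_setI _ mX mu_X); last first.
  by rewrite -[X in measurable X]setTI; exact: (measurable_code_ext pi_code).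
congr (mu _); apply/seteqP; split=> x [].
  by rewrite /preimage/= => + Xx; rewrite code_extE.
by move=> Xx; rewrite /preimage/= code_extE.
Qed.

Lemma holonomy_measure_transport (psi : holonomy X) E : measurable E ->
  holonomy_measure nu (transport_holonomy pi_code pi_ai mdY psi) (pi @` (E `&` X0)) =
  holonomy_measure mu psi E.
Proof.
move=> mE; rewrite /holonomy_measure transport_holonomy_image.
rewrite measure_image_regular_points// Defs.holonomy_imageE.
by apply: measurable_hol_inv => //; exact: measurable_hol_cod.
Qed.

(** Both functions have the same integral over every Borel E: each gives the transported holonomy
    measure of the image of the regular part of E. *)
Lemma lift_radon_nikodym (psi : holonomy X) : nonsingular Y nu ->
  ae_eq mu setT
    ('d (charge_of_finite_measure (holonomy_measure mu psi)) '/d mu)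
    ('d (charge_of_finite_measure (holonomy_measure nu
      (transport_holonomy pi_code pi_ai mdY psi))) '/d nu \o code_ext X pi).
Proof.
move=> nu_ns; set psi' := transport_holonomy _ _ _ _.
have mu_dom : charge_of_finite_measure (holonomy_measure mu psi) `<< mu.
  exact: nonsingular_dominates (lift_nonsingular nu_ns).
have nu_dom : charge_of_finite_measure (holonomy_measure nu psi') `<< nu.
  exact: nonsingular_dominates nu_ns.
set h := 'd (charge_of_finite_measure (holonomy_measure nu psi')) '/d nu.
have int_h : nu.-integrable setT h by exact: Radon_Nikodym_integrable.
have mext := measurable_code_ext pi_code.
have int_hf := integrable_measure_preserving mext ext_mu int_h.
apply: integral_ae_eq => //.
- exact: Radon_Nikodym_integrable.
- by have /integrableP[] := int_hf.
move=> E _ mE; have mF := measurable_image mE.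
rewrite -Radon_Nikodym_integral//.
transitivity (\int[nu]_(y in pi @` (E `&` X0)) h y).
  rewrite /h -Radon_Nikodym_integral//.
  exact/esym/holonomy_measure_transport.
(* The two domains of integration agree only on regular points, so the null remainder is removed
   from both. *)
have muC : mu (~` X0) = 0 by exact: probability_full_setC0.
have mCX0 : measurable (~` X0) by exact: measurableC.
have mpF : measurable (code_ext X pi @^-1` (pi @` (E `&` X0))).
  by rewrite -[X in measurable X]setTI; exact: mext.
rewrite (integral_measure_preserving mext ext_mu int_h mF).
rewrite (negligible_integral mCX0)//; last exact: integrableS int_hf.
rewrite [RHS](negligible_integral mCX0)//; last exact: integrableS int_hf.
congr (integral _ _ _); rewrite !setDE setCK.
rewrite -[RHS](preimage_image_regular_points pi_ai).
apply/seteqP; split=> x.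
  by rewrite /preimage/= => -[+ [Xx x0]]; rewrite code_extE.
move=> xP; have [Ex x0] : (E `&` X0) x.
  by rewrite -(preimage_image_regular_points pi_ai).
by split=> //; rewrite /preimage/= code_extE; [exact: xP.2|exact: x0.1].
Qed.

Lemma lift_gibbs_measure phi : gibbs_measure Y phi nu ->
  gibbs_measure X (fun p => phi (pi p.1, pi p.2)) mu.
Proof.
move=> [phi_coc nu_ns nu_phi]; split.
- exact: cocycle_factor_code phi_coc.
- exact: lift_nonsingular.
move=> psi; pose psi' := transport_holonomy pi_code pi_ai mdY psi.
(* The exceptional null set of the Gibbs identity on Y; its preimage is null for [mu]. *)
have [N [mN nuN PN]] := nu_phi psi'.
have ae_N : \forall x \ae mu, ~ N (code_ext X pi x).
  exists (code_ext X pi @^-1` N); split.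
  - by rewrite -[X in measurable X]setTI; exact: (measurable_code_ext pi_code).
  - by rewrite ext_mu.
  - by move=> x /= /contrapT.
have ae_X0 : \forall x \ae mu, X0 x.
  exists (~` X0); split=> //; first exact: measurableC.
  exact: probability_full_setC0.
apply: filterS3 (lift_radon_nikodym psi nu_ns) ae_N ae_X0 => x RNx Nx x0 xD.
rewrite RNx// /= code_extE; last exact: x0.1.
rewrite code_extE in Nx; last exact: x0.1.
have RNy : hol_dom psi' (pi x) ->
    ('d (charge_of_finite_measure (holonomy_measure nu psi')) '/d nu) (pi x) =
    (expR (phi (pi x, hol_fun psi' (pi x))))%:E.
  exact: contrapT (contra_not (@PN (pi x)) Nx).
rewrite RNy ?transport_holonomy_fun//.
rewrite transport_holonomy_domE; split; first exact: x0.2.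
by rewrite /preimage/= (code_invK pi_ai x0).
Qed.

End lift_measure.

Local Open Scope ereal_scope.

Theorem proposition3p11 (R : realType) (A B : alphabetType)
  (X : set (full_shift A)) (Y : set (full_shift B))
  (pi : full_shift A -> full_shift B)
  (X_irr : irreducible_shift X) (X_SFT : SFT X) (Y_sofic : sofic Y)
  (pi_code : factor_code X Y pi) (pi_ai : almost_invertible X Y pi)
  (nu : probability (full_shift B) R)
  (nu_Y : measure_on Y nu) (nu_full : fully_supported Y nu)
  (nu_inv : shift_invariant nu) (nu_erg : ergodic Y nu)
  (nu_ns : nonsingular Y nu)
  (phi : full_shift B * full_shift B -> R) (phi_coc : cocycle Y phi)
  (nu_gibbs : gibbs_measure Y phi nu)
  (mu : probability (full_shift A) R)
  (mu_X : measure_on X mu) (mu_inv : shift_invariant mu)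
  (pi_mu : forall E, measurable E -> mu (X `&` pi @^-1` E) = nu E) :
  nonsingular X mu /\
  (shift_invariant mu /\
   gibbs_measure X (fun p => phi (pi p.1, pi p.2)) mu).
Proof.
have Y_shift : shift_space Y by case: pi_code.
have mdY := measurable_doubly_transitive Y_shift.
(* Full support, invariance and ergodicity of [nu] enter through this fact. *)
have nu_dY := measure_doubly_transitive Y_shift nu_Y nu_full nu_inv nu_erg.
split; first exact: (lift_nonsingular pi_code pi_ai mdY nu_dY).
split; first exact: mu_inv.
exact: (lift_gibbs_measure pi_code pi_ai mdY nu_dY).
Qed.
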